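(* Let $n\ge2$, $N\ge1$, and let $\lambda=(\lambda_1\ge\dots\ge\lambda_n\ge0)$ be an $n$-partition of $N$. Then the ideal $\bigoplus_\nu I^\lambda_\nu$ of $\bigoplus_\nu P_\nu$ (sums over all $n$-compositions $\nu$ of $N$) is invariant under the operators $E_{i,j}$ and $F_{i,j}$ for all $i\in\{1,\dots,n-1\}$ and $j\ge0$; that is, $E_{i,j}(I^\lambda_\nu)\subseteq I^\lambda_{\nu+\alpha_i}$ whenever $\nu_{i+1}>0$, and $F_{i,j}(I^\lambda_\nu)\subseteq I^\lambda_{\nu-\alpha_i}$ whenever $\nu_i>0$.
   Context: Ground field $\mathbb C$. An $n$-composition of $N$ is an $n$-tuple of non-negative integers with sum $N$; an $n$-partition is a weakly decreasing one. $\alpha_i=(0,\dots,0,1,-1,0,\dots,0)$ with $1$ in position $i$. $P_\nu\subset\mathbb C[X_1,\dots,X_N]$ is the subring of polynomials invariant under $S_{\nu_1}\times\dots\times S_{\nu_n}$ (the first factor permutes the first $\nu_1$ variables, the second the next $\nu_2$, etc.). $e_r(\nu;i),h_r(\nu;i)$ are the $r$-th elementary and complete symmetric polynomials in the $i$-th block of variables $\{X_k:\nu_1+\dots+\nu_{i-1}<k\le\nu_1+\dots+\nu_i\}$; $e_r=h_r=0$ for $r<0$, $e_0=h_0=1$. For $1\le i_1<\dots<i_m\le n$, $h_r(\nu;i_1,\dots,i_m)=\sum_{r_1+\dots+r_m=r}h_{r_1}(\nu;i_1)\cdots h_{r_m}(\nu;i_m)$, the $r$-th complete symmetric polynomial in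 the union of blocks $i_1,\dots,i_m$. $I^\lambda_\nu$ is the ideal of $P_\nu$ generated by all $h_r(\nu;i_1,\dots,i_m)$ with $1\le m\le n$, $1\le i_1<\dots<i_m\le n$ and $r>\lambda_1+\dots+\lambda_m-\nu_{i_1}-\dots-\nu_{i_m}$. Operators: let $k_i=\nu_1+\dots+\nu_i$, and let $c_{i,\bar\nu}\in\mathbb C^*$ be fixed nonzero scalars. Let $P_{\nu-\alpha_i,\nu}$ be the ring of polynomials invariant under the Young subgroup of the $(n+1)$-composition $(\nu_1,\dots,\nu_{i-1},\nu_i-1,1,\nu_{i+1},\dots,\nu_n)$ (for $\nu_i>0$) and $P_{\nu+\alpha_i,\nu}$ the one for $(\nu_1,\dots,\nu_i,1,\nu_{i+1}-1,\dots,\nu_n)$ (for $\nu_{i+1}>0$). These contain $P_\nu$ and are spanned over $P_{\nu-\alpha_i}$ by the powers of $X_{k_i}$, respectively over $P_{\nu+\alpha_i}$ by the powers of $X_{k_i+1}$. For $\nu_i>0$, $F_{i,j}\colon P_\nu\to P_{\nu-\alpha_i}$ is the restriction to $P_\nu$ of the $P_{\nu-\alpha_i}$-linear map $P_{\nu-\alpha_i,\nu}\to P_{\nu-\alpha_i}$ with $$X_{k_i}^m\mapsto c_{i,\bar\nu}^{-1}\sum_{l=0}^{\nu_i-1}(-1)^l e_l(\nu-\alpha_i;i)\,h_{m+j+\nu_i-\nu_{i+1}-1-l}(\nu-\alpha_i;i+1)\quad(m\ge0).$$ For $\nu_{i+1}>0$, $E_{i,j}\colon P_\nu\to P_{\nu+\alpha_i}$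 is the restriction to $P_\nu$ of the $P_{\nu+\alpha_i}$-linear map $P_{\nu+\alpha_i,\nu}\to P_{\nu+\alpha_i}$ with $$X_{k_i+1}^m\mapsto c_{i,\bar\nu}\sum_{l=0}^{\nu_{i+1}-1}(-1)^l e_l(\nu+\alpha_i;i+1)\,h_{m+j+\nu_{i+1}-\nu_i-1-l}(\nu+\alpha_i;i)\quad(m\ge0).$$ $F_{i,j}=0$ on $P_\nu$ if $\nu_i=0$, and $E_{i,j}=0$ on $P_\nu$ if $\nu_{i+1}=0$. (These are the operators by which the generators $E_{i,j},F_{i,j}$ of the current algebra $\mathbf U(\mathfrak{sl}_n[t])$ act on $\bigoplus_\nu P_\nu$.) *)

(* Defs.v *)
From mathcomp Require Import all_boot all_order all_algebra all_fingroup.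
From mathcomp Require Import mpoly complex reals.

Set Implicit Arguments.
Unset Strict Implicit.
Unset Printing Implicit Defensive.

Import Order.TTheory GRing.Theory Num.Theory.
Local Open Scope ring_scope.

(* Conventions.  Compositions are sequences of natural numbers.  Positions in *)
(* a composition, blocks and variables are all numbered from 0, so that the   *)
(* position i below is the mathematical i + 1.                                *)

Section Compositions.

Implicit Types (nu : seq nat) (i : nat).

Definition is_composition N nu := sumn nu == N.

Definition is_partition N nu := sorted geq nu && (sumn nu == N).

(* nu + alpha_i and nu - alpha_i.  The subtraction of naturals is truncated:  *)
(* these are meant for 0 < nu_(i+1) and 0 < nu_i respectively.                *)
Definition add_alpha nu i : seq nat :=
  mkseq (fun k => (nth 0 nu k + (k == i) - (k == i.+1))%N) (size nu).

Definition sub_alpha nu i : seq nat :=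
  mkseq (fun k => (nth 0 nu k + (k == i.+1) - (k == i))%N) (size nu).

(* The refinements (.., nu_i - 1, 1, nu_(i+1), ..) and                        *)
(* (.., nu_i, 1, nu_(i+1) - 1, ..) of nu.                                     *)
Definition refine_sub nu i : seq nat :=
  take i nu ++ [:: (nth 0 nu i).-1, 1 & drop i.+1 nu]%N.

Definition refine_add nu i : seq nat :=
  take i.+1 nu ++ [:: 1, (nth 0 nu i.+1).-1 & drop i.+2 nu]%N.

(* The number of variables in the blocks 0, .., i.                            *)
Definition block_end nu i : nat := sumn (take i.+1 nu).

Definition block N nu i : {set 'I_N} :=
  [set k : 'I_N | sumn (take i nu) <= k < sumn (take i.+1 nu)]%N.

Definition young N nu : {set 'S_N} :=
  [set s : 'S_N | [forall i : 'I_(size nu), forall k in block N nu i,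
                     s k \in block N nu i]].

End Compositions.

Section Polynomials.

Variables (K : fieldType) (N : nat).
Local Notation Pol := {mpoly K[N]}.
Implicit Types (nu la : seq nat) (A : {set 'I_N}).

(* The ring P_nu.                                                             *)
Definition young_inv nu : {pred Pol} :=
  [pred p : Pol | [forall s in young N nu, msym s p == p]].

(* The variable with 0-based number k; the value 0 for N <= k is junk.        *)
Definition var (k : nat) : Pol :=
  if insub k is Some k' then 'X_k' else 0.

Definition esym A (r : nat) : Pol :=
  \sum_(B : {set 'I_N} | (B \subset A) && (#|B| == r)) \prod_(k in B) 'X_k.

Definition hsym A (r : int) : Pol :=
  if r is Posz d then
    \sum_(m : 'X_{1..N < d.+1} |
            (mdeg m == d) && [forall k, (m k != 0%N) ==> (k \in A)]) 'X_[m]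
  else 0.

Definition esym_block nu i r : Pol := esym (block N nu i) r.

Definition hsym_block nu i r : Pol := hsym (block N nu i) r.

(* h_r(nu; i_1, .., i_m), with s listing i_1, .., i_m.  Only non-negative     *)
(* parts are summed over, the others contributing 0.                          *)
Definition hsym_blocks nu (s : seq nat) (r : int) : Pol :=
  if r is Posz d then
    \sum_(a : {ffun 'I_(size s) -> 'I_d.+1} | (\sum_t a t)%N == d)
      \prod_(t < size s) hsym_block nu (nth 0%N s t) (a t : nat)%:Z
  else 0.

(* The ideal of the ring A generated by G.                                    *)
Definition ideal_generated (A : {pred Pol}) (G : Pol -> Prop) (f : Pol) : Prop :=
  exists ps : seq (Pol * Pol),
    (forall p, p \in ps -> p.1 \in A /\ G p.2) /\
    f = \sum_(p <- ps) p.1 * p.2.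

Definition ideal_gens la nu (g : Pol) : Prop :=
  exists (s : seq nat) (r : int),
    [/\ s != [::], sorted ltn s, all (fun i => i < size nu)%N s,
        (sumn (take (size s) la))%:Z - (\sum_(i <- s) nth 0 nu i)%N%:Z < r
      & g = hsym_blocks nu s r].

Definition Ideal la nu : Pol -> Prop :=
  ideal_generated (young_inv nu) (ideal_gens la nu).

(* Phi restricts to an A-linear map B -> A; its values off B are irrelevant.  *)
Definition linear_map_from_to (B A : {pred Pol}) (Phi : Pol -> Pol) : Prop :=
  (forall f, f \in B -> Phi f \in A) /\
  (forall a f g, a \in A -> f \in B -> g \in B ->
     Phi (a * f + g) = a * Phi f + Phi g).

(* Phi restricts to the linear map P_(nu - alpha_i, nu) -> P_(nu - alpha_i)   *)
(* whose restriction to P_nu is F_(i,j), with scalar c.  The variable X_(k_i) *)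
(* is the last one of block i of nu, hence has 0-based number k_i - 1.        *)
Definition extends_F (c : K) nu (i j : nat) (Phi : Pol -> Pol) : Prop :=
  linear_map_from_to (young_inv (refine_sub nu i))
                     (young_inv (sub_alpha nu i)) Phi /\
  forall m : nat,
    Phi (var (block_end nu i).-1 ^+ m) =
    c^-1 *: \sum_(l < nth 0%N nu i)
      (-1) ^+ l * esym_block (sub_alpha nu i) i l *
      hsym_block (sub_alpha nu i) i.+1
        (m%:Z + j%:Z + (nth 0%N nu i)%:Z - (nth 0%N nu i.+1)%:Z - 1 - (l : nat)%:Z).

(* Likewise for E_(i,j); X_(k_i + 1) is the first variable of block i + 1.    *)
Definition extends_E (c : K) nu (i j : nat) (Phi : Pol -> Pol) : Prop :=
  linear_map_from_to (young_inv (refine_add nu i))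
                     (young_inv (add_alpha nu i)) Phi /\
  forall m : nat,
    Phi (var (block_end nu i) ^+ m) =
    c *: \sum_(l < nth 0%N nu i.+1)
      (-1) ^+ l * esym_block (add_alpha nu i) i.+1 l *
      hsym_block (add_alpha nu i) i
        (m%:Z + j%:Z + (nth 0%N nu i.+1)%:Z - (nth 0%N nu i)%:Z - 1 - (l : nat)%:Z).

End Polynomials.

(* Main.v *)
(* Adding alpha_i to nu, or subtracting it, moves a single variable x from a   *)
(* block A to a block B; in both cases x^m is sent to a multiple of the        *)
(* coefficient of T^(m + j + |A| - |B| - 1) in H_(B + x)(T) / H_(A - x)(T).    *)
(* The polynomials fixed by the common refinement are spanned by the powers of *)
(* x over the target ring, so it suffices to treat x^m h_r(U), for U a union   *)
(* of blocks of nu with h_r(U) a generator.  If U contains both or neither of  *)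
(* A and B, then h_r(U) is a scalar and again a generator.  If U contains only *)
(* B, then h_r(U) = h_r(U + x) - x h_(r-1)(U + x), both generators.  If U      *)
(* contains only A, then h_r(U) = sum_s x^s h_(r-s)(U - x), and modulo the     *)
(* generators h_q(U - x) with q > r the image is a single coefficient of       *)
(* H_(U-x) H_(B+x) / H_(A-x) = H_(U - A + B + x), which is a generator.        *)

Require Import Defs.
From HB Require Import structures.
From mathcomp Require Import all_boot all_order all_algebra all_fingroup.
From mathcomp Require Import mpoly complex reals.
From mathcomp Require Import zify ring.

Set Implicit Arguments.
Unset Strict Implicit.
Unset Printing Implicit Defensive.

Import Order.TTheory GRing.Theory Num.Theory.
Local Open Scope ring_scope.

Arguments hsym : simpl never.

(** * Elementary and complete symmetric polynomials in a set of variables *)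

Section SymmetricPolynomials.

Variables (K : fieldType) (N : nat).
Local Notation Pol := {mpoly K[N]}.
Local Notation hsym := (@hsym K N).
Local Notation esym := (@Defs.esym K N).
Implicit Types (A B C D : {set 'I_N}) (x : 'I_N) (r : int).

(** Write H_S(T) for the generating series of the [hsym S r], that is the product of 1/(1 - X_k T)
    over k in S. Both operators are instances of one situation: a variable x leaves block [a] of
    [nu] and joins block [b] of [mu], and [Phi] sends x^m to a scalar multiple of a coefficient of
    H_B/H_A, where A and B are the blocks [a] and [b] of [mu], so that x lies in B and not in A. By
    [young_inv_span], every element of P_nu is a combination of powers of x with coefficients in
    P_mu, so it suffices to treat x^m h_r(U) with h_r(U) a generator. The threshold for r depends
    only on the number of blocks in the union and on their total size. It is thus unchanged if the
    union contains both or neither of [a] and [b] ([Ideal_move_same]), and drops by one if the union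
    gains x, which is just enough for both h_r and h_(r-1) of the new union ([Ideal_move_gain]). If
    the union loses x ([Ideal_move_lose]), expanding h_r(U) in powers of x gives a truncated
    convolution of H_(U-x) with H_B/H_A. By [hsym_setD_split] it is a full coefficient of H_(U-x)
    H_B/H_A = H_((U-x)+B-A), up to multiples of h_q(U-x) with q > r. Exchanging block [a] for block
    [b] keeps the number of blocks, and the shift built into the operator matches the change in
    size, so the full coefficient is again a generator. [Ideal_E] and [Ideal_F] are the two
    instances. *)

Lemma mcoeff_hsym A (d : nat) m :
  (hsym A d%:Z)@_m = ((mdeg m == d) && [forall k, (m k != 0%N) ==> (k \in A)])%:R.
Proof.
rewrite /Defs.hsym raddf_sum.
case: (boolP (_ && _)) => [/andP [/eqP md mA]|h].
  have lt : (mdeg m < d.+1)%N by rewrite md.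
  rewrite (bigD1 (BMultinom lt)) /=; last by rewrite md eqxx mA.
  rewrite mcoeffX eqxx big1 ?addr0 // => k /andP [_ ne].
  by rewrite mcoeffX; case: eqP => // e; case/eqP: ne; apply/val_inj.
rewrite big1 // => k hk /=; rewrite mcoeffX; case: eqP => // e.
by rewrite -e hk in h.
Qed.

Lemma hsym_lt0 A r : r < 0 -> hsym A r = 0.
Proof. by case: r. Qed.

Lemma hsym0 A : hsym A 0 = 1.
Proof.
apply/mpolyP => m; rewrite mcoeff_hsym mcoeff1 mdeg_eq0.
case: eqP => //= ->; congr (_%:R); apply/eqP; rewrite eqb1.
by apply/forallP => k; rewrite mnm0E.
Qed.

Lemma mcoeffXM (x : 'I_N) (p : Pol) m :
  ('X_x * p)@_m = if m x == 0%N then 0 else p@_(m - U_(x))%MM.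
Proof.
case: ifPn => [/eqP mx|mx]; last first.
  have le : (U_(x) <= m)%MM by rewrite lep1mP.
  by rewrite -{1}(submK le) addmC mulrC mcoeffMX.
apply: memN_msupp_eq0; apply/negP => /msuppM_le /allpairsP [[a b]] /= [].
rewrite msuppX inE => /eqP -> _ e; move: mx.
by rewrite e mnmDE mnm1E eqxx.
Qed.

(** This is H_(A+x) (1 - xT) = H_A. On coefficients, the monomials free of X_x come from [A], and
    the others are X_x times a monomial of degree one less. *)
Lemma hsymU1 x A r :
  x \notin A -> hsym (x |: A) r = hsym A r + 'X_x * hsym (x |: A) (r - 1).
Proof.
move=> xA; have [r0|] := ltrP r 0; first by rewrite !hsym_lt0 ?mulr0 ?addr0 //; lia.
case: r => [[|d]|//] _; first by rewrite !hsym0 hsym_lt0 // mulr0 addr0.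
have -> : d.+1%:Z - 1 = d%:Z by lia.
apply/mpolyP => m; rewrite mcoeffD mcoeffXM !mcoeff_hsym.
case: ifPn => [/eqP mx|mx].
  rewrite addr0; congr ((_ && _)%:R); apply: eq_forallb => k.
  by rewrite !inE; have [->|//] := eqVneq k x; rewrite mx.
have le : (U_(x) <= m)%MM by rewrite lep1mP.
rewrite (_ : [forall k, _ ==> (k \in A)] = false) ?andbF ?add0r; last first.
  by apply/negP => /forallP /(_ x); rewrite mx (negbTE xA).
congr ((_ && _)%:R).
  by rewrite -{1}(submK le) mdegD mdeg1 addn1.
apply: eq_forallb => k; rewrite mnmBE mnm1E !inE.
by have [_|_] := eqVneq x k; rewrite /= ?implybT ?subn0.
Qed.

Lemma hsym_set0 (d : nat) : hsym set0 d%:Z = (d == 0%N)%:R.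
Proof.
case: d => [|d]; first by rewrite hsym0.
apply/mpolyP => m; rewrite mcoeff_hsym mcoeff0; case: eqP => //= md.
case: forallP => // h; move: md; rewrite mdegE big1 // => k _.
by have := h k; rewrite inE implybF negbK => /eqP.
Qed.

Lemma finset_ind (P : {set 'I_N} -> Prop) :
  P set0 -> (forall x A, x \notin A -> P A -> P (x |: A)) -> forall A, P A.
Proof.
move=> P0 PU A; have [k] := ubnP #|A|; elim: k A => // k IH A le.
have [->//|[x xA]] := set_0Vmem A; rewrite -(setD1K xA); apply: PU.
  by rewrite !inE eqxx.
by apply: IH; move: le; rewrite (cardsD1 x) xA.
Qed.

(** Iterating [hsymU1] expands 1/(1 - xT) as a geometric series. Any [M] above [r] will do, since
    the terms with s > r vanish. *)
Lemma hsymU1_sum x A r (M : nat) : x \notin A -> r < M%:Z ->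
  hsym (x |: A) r = \sum_(s < M) 'X_x ^+ s * hsym A (r - s%:Z).
Proof.
move=> xA; elim: M r => [|M IH] r lt; first by rewrite big_ord0 hsym_lt0.
rewrite hsymU1 // big_ord_recl subr0 mul1r (IH (r - 1)); last by lia.
congr (_ + _); rewrite mulr_sumr; apply: eq_bigr => s _.
by rewrite exprS mulrA; congr (_ * hsym _ _); rewrite lift0; lia.
Qed.

(** The Cauchy product H_(A+B) = H_A H_B, by adding the variables of [A] one at a time. *)
Lemma hsymU A B r (M : nat) : [disjoint A & B] -> r < M%:Z ->
  hsym (A :|: B) r = \sum_(q < M) hsym A q%:Z * hsym B (r - q%:Z).
Proof.
elim/finset_ind: A r M => [|x A xA IHA] r M dAB lt.
  case: M lt => [|M] lt; first by rewrite big_ord0 hsym_lt0.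
  rewrite set0U big_ord_recl hsym0 mul1r subr0 big1 ?addr0 // => q _.
  by rewrite lift0 hsym_set0 mul0r.
have xB := disjointFr dAB (setU11 x A).
have {}dAB := disjointWl (subsetUr _ _) dAB.
have xAB : x \notin A :|: B by rewrite inE negb_or xA xB.
(* [hsymU1] lowers the degree by one while keeping the set, so a second induction, on the length of
   the sum, is nested in the one on [A]. *)
elim: M r lt => [|M IH] r lt; first by rewrite big_ord0 hsym_lt0.
rewrite -setUA hsymU1 // setUA IH; last by lia.
rewrite (IHA _ M.+1) //.
under [RHS]eq_bigr do rewrite hsymU1 // mulrDl.
rewrite big_split /=; congr (_ + _); rewrite [RHS]big_ord_recl.
rewrite hsym_lt0 // mulr0 mul0r add0r mulr_sumr; apply: eq_bigr => q _.
by rewrite -mulrA; congr (_ * (hsym _ _ * hsym _ _)); rewrite lift0; lia.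
Qed.

Lemma esym0 A : esym A 0 = 1.
Proof.
rewrite /Defs.esym (bigD1 set0) /= ?sub0set ?cards0 // big_set0.
rewrite big1 ?addr0 // => B /andP [/andP [_]].
by rewrite cards_eq0 => ->.
Qed.

Lemma esym_gt A (l : nat) : (#|A| < l)%N -> esym A l = 0.
Proof.
move=> lt; rewrite /Defs.esym big1 // => B /andP [sBA /eqP cB].
by have := subset_leq_card sBA; rewrite cB leqNgt lt.
Qed.

Lemma esymU1 x A (l : nat) :
  x \notin A -> esym (x |: A) l.+1 = esym A l.+1 + 'X_x * esym A l.
Proof.
move=> xA; rewrite /Defs.esym (bigID (fun B : {set 'I_N} => x \in B)) /= addrC.
congr (_ + _).
  apply: eq_bigl => B; rewrite andbAC; congr (_ && _).
  apply/andP/idP => [[sB xB]|sB].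
    by rewrite -(setU1K xA) subsetD1 sB.
  split; first by apply: subset_trans sB _; apply: subsetUr.
  by apply: contra xA; apply: (subsetP sB).
rewrite mulr_sumr (reindex_onto (fun B => x |: B) (fun B => B :\ x)) /=; last first.
  by move=> B /andP [_ xB]; rewrite setD1K.
have xN B : B \subset A -> x \notin B by move=> sB; apply: contra xA; apply: (subsetP sB).
apply: eq_big => [B|B /andP [/andP [/andP [sB cB] xB] /eqP e]]; last first.
  have nx : x \notin B by rewrite -e !inE eqxx.
  by rewrite big_setU1.
rewrite setU11 andbT; apply/andP/andP => [[/andP [sB cB] /eqP e]|[sB cB]].
  have nx : x \notin B by rewrite -e !inE eqxx.
  move: cB; rewrite cardsU1 nx add1n eqSS => ->; split=> //.
  by rewrite -e -(setU1K xA) setSD.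
by rewrite setUS // cardsU1 xN // setU1K ?xN // add1n eqSS cB eqxx.
Qed.

(** Multiplying H_C by the product of the 1 - X_k T over k in [A] cancels the factors of [A]. Since
    e_l(A) = 0 beyond #|A|, every sum with more than #|A| terms is complete; this gives H_B/H_A its
    polynomial meaning. *)
Lemma sum_esym_hsym A C r (M : nat) : A \subset C -> (#|A| < M)%N ->
  \sum_(l < M) (-1) ^+ l * esym A l * hsym C (r - (l : nat)%:Z) = hsym (C :\: A) r.
Proof.
elim/finset_ind: A r M => [|x A xA IH] r [|M] //.
  move=> _ _; rewrite big_ord_recl esym0 !mul1r subr0 setD0 big1 ?addr0 // => l _.
  by rewrite esym_gt ?cards0 // mulr0 mul0r.
rewrite cardsU1 xA add1n ltnS => sAC lt.
have [xC sA] : x \in C /\ A \subset C by move: sAC; rewrite subUset sub1set => /andP.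
have e : hsym (C :\: A) r = hsym (C :\: (x |: A)) r + 'X_x * hsym (C :\: A) (r - 1).
  have -> : C :\: A = x |: (C :\: (x |: A)).
    by apply/setP => k; rewrite !inE; case: eqP => //= ->; rewrite xC xA.
  by rewrite -hsymU1 // !inE eqxx.
(* The added term turns the right side into h_r(C - A). The induction hypothesis, in degrees r and r
   - 1, then reduces the goal to the recursion [esymU1]. *)
apply/(addIr ('X_x * hsym (C :\: A) (r - 1))); rewrite -e.
rewrite -(IH r M.+1) // ?(leq_trans lt) // -(IH (r - 1) M) //.
rewrite !big_ord_recl !esym0 -addrA; congr (_ + _).
rewrite mulr_sumr -big_split; apply: eq_bigr => l _.
rewrite lift0 esymU1 // (_ : r - 1 - l%:Z = r - l.+1%:Z); last by lia.
by rewrite exprS /=; ring.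
Qed.

Lemma msym_hsym A (s : 'S_N) r :
  (forall k, (s k \in A) = (k \in A)) -> msym s (hsym A r) = hsym A r.
Proof.
move=> sA; case: r => d; last by rewrite !hsym_lt0 // msym0.
apply/mpolyP => m; rewrite mcoeff_sym !mcoeff_hsym mdeg_mperm.
congr ((_ && _)%:R); apply/forallP/forallP => h k.
  by have := h (s^-1 k)%g; rewrite mnmE -sA permKV.
by have := h (s k); rewrite mnmE sA.
Qed.

Lemma msymXU (s : 'S_N) x : msym s ('X_x : Pol) = 'X_(s x).
Proof.
rewrite msymX; congr 'X_[_]; apply/mnmP => k; rewrite mnmE !mnm1E.
by rewrite -(inj_eq (@perm_inj _ s)) permKV.
Qed.

Lemma msym_esym A (s : 'S_N) (l : nat) :
  (forall k, (s k \in A) = (k \in A)) -> msym s (esym A l) = esym A l.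
Proof.
move=> sA; have sI := @perm_inj _ s.
have sAE : s @: A = A.
  apply/eqP; rewrite eqEcard card_imset // leqnn andbT.
  by apply/subsetP => _ /imsetP [k kA ->]; rewrite sA.
rewrite /Defs.esym raddf_sum /=.
rewrite [RHS](reindex_inj (imset_inj sI)) /=; apply: eq_big => [B|B _].
  rewrite card_imset // -{2}sAE; congr (_ && _).
  apply/idP/idP; first exact: imsetS.
  move=> /subsetP h; apply/subsetP => k kB.
  by have /imsetP [k' k'A /sI ->] := h _ (imset_f s kB).
rewrite rmorph_prod big_imset /=; last by move=> ? ? _ _; apply: sI.
by apply: eq_bigr => k _; rewrite msymXU.
Qed.

End SymmetricPolynomials.

(** * Invariants of Young subgroups *)

Section Blocks.

Variable N : nat.
Implicit Types (nu : seq nat) (s : 'S_N).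

Lemma leq_sumn_take nu i j : (i <= j)%N -> (sumn (take i nu) <= sumn (take j nu))%N.
Proof. by move=> /subnKC <-; rewrite takeD sumn_cat leq_addr. Qed.

Lemma sumn_takeS nu i : sumn (take i.+1 nu) = (sumn (take i nu) + nth 0 nu i)%N.
Proof.
have [lt|le] := ltnP i (size nu).
  by rewrite (take_nth 0%N lt) sumn_rcons.
by rewrite !take_oversize ?nth_default ?addn0 // leqW.
Qed.

Lemma in_block nu i (k : 'I_N) :
  (k \in block N nu i) = (sumn (take i nu) <= k < sumn (take i.+1 nu))%N.
Proof. by rewrite inE. Qed.

Lemma block_inj nu i j (k : 'I_N) :
  k \in block N nu i -> k \in block N nu j -> i = j.
Proof.
rewrite !in_block => /andP [li ui] /andP [lj uj].
case: (ltngtP i j) => // lt.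
  by have := leq_sumn_take nu lt; rewrite leqNgt (leq_ltn_trans lj ui).
by have := leq_sumn_take nu lt; rewrite leqNgt (leq_ltn_trans li uj).
Qed.

(** The bound serves to show that the sum over l in the operators reaches all nonzero e_l of the
    block, as [sum_esym_hsym] requires. *)
Lemma card_block nu i : (#|block N nu i| <= nth 0 nu i)%N.
Proof.
rewrite cardE -(size_map val) -(size_iota (sumn (take i nu)) (nth 0%N nu i)).
apply: uniq_leq_size; first by rewrite (map_inj_uniq val_inj) enum_uniq.
move=> _ /mapP [k kB ->]; move: kB.
by rewrite mem_enum in_block mem_iota -sumn_takeS.
Qed.

Lemma block_oversize nu i : (size nu <= i)%N -> block N nu i = set0.
Proof.
move=> le; apply/setP => k; rewrite in_block inE sumn_takeS nth_default //.
by rewrite addn0 leqNgt andNb.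
Qed.

Lemma youngP nu s :
  reflect (forall i k, (s k \in block N nu i) = (k \in block N nu i)) (s \in young N nu).
Proof.
rewrite inE; apply: (iffP forallP) => [h i k|h i]; last first.
  by apply/forallP => k; rewrite h implybb.
have [lt|le] := ltnP i (size nu); last by rewrite block_oversize // !inE.
(* [young] only asks that blocks be mapped into themselves; by injectivity on a finite set they are
   mapped onto themselves. *)
have sB : s @: block N nu i = block N nu i.
  apply/eqP; rewrite eqEcard card_imset ?leqnn ?andbT; last exact: perm_inj.
  apply/subsetP => _ /imsetP [k' k'B ->].
  by have /forallP /(_ k') := h (Ordinal lt); rewrite k'B.
by rewrite -{1}sB mem_imset //; apply: perm_inj.
Qed.

Lemma youngM nu s t : s \in young N nu -> t \in young N nu -> (s * t)%g \in young N nu.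
Proof.
move=> /youngP hs /youngP ht; apply/youngP => i k.
by rewrite permM ht hs.
Qed.

Lemma young_tperm nu i (y z : 'I_N) :
  y \in block N nu i -> z \in block N nu i -> tperm y z \in young N nu.
Proof.
move=> yB zB; apply/youngP => j k; have [->|->|//] := tpermP.
  by apply/idP/idP => h; rewrite -?(block_inj zB h) -?(block_inj yB h).
by apply/idP/idP => h; rewrite -?(block_inj zB h) -?(block_inj yB h).
Qed.

End Blocks.

(** * The invariant rings and the symmetric polynomials of unions of blocks *)

Section YoungInvariants.

Variables (K : fieldType) (N : nat).
Local Notation Pol := {mpoly K[N]}.
Local Notation hsym := (@hsym K N).
Local Notation esym := (@Defs.esym K N).
Local Notation young_inv := (@young_inv K N).
Implicit Types (nu : seq nat) (s : 'S_N) (x : 'I_N) (f g : Pol).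

Lemma young_invP nu f :
  reflect (forall s, s \in young N nu -> msym s f = f) (f \in young_inv nu).
Proof.
rewrite inE; apply: (iffP forallP) => [h s sY|h s].
  by have := h s; rewrite sY => /eqP.
by apply/implyP => /h /eqP.
Qed.

Lemma young_inv_subring nu : subring_closed (young_inv nu).
Proof.
split=> [|f g|f g]; first by apply/young_invP => s _; rewrite msym1.
  by move=> /young_invP hf /young_invP hg; apply/young_invP => s sY; rewrite msymB hf ?hg.
by move=> /young_invP hf /young_invP hg; apply/young_invP => s sY; rewrite msymM hf ?hg.
Qed.

HB.instance Definition _ nu :=
  GRing.isSubringClosed.Build Pol (young_inv nu) (young_inv_subring nu).

Lemma young_invZ nu (c : K) f : f \in young_inv nu -> c *: f \in young_inv nu.
Proof. by move=> /young_invP hf; apply/young_invP => s sY; rewrite msymZ hf. Qed.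

Lemma esym_block_inv nu i l : esym_block K N nu i l \in young_inv nu.
Proof. by apply/young_invP => s /youngP sY; rewrite msym_esym. Qed.

Definition blocks nu (t : seq nat) : {set 'I_N} := \bigcup_(i <- t) block N nu i.

Lemma in_blocks nu t k : (k \in blocks nu t) = has (fun i => k \in block N nu i) t.
Proof.
rewrite /blocks; elim: t => [|i t IH]; first by rewrite big_nil inE.
by rewrite big_cons inE IH.
Qed.

Lemma hsym_blocks_inv nu t r : hsym (blocks nu t) r \in young_inv nu.
Proof.
apply/young_invP => s /youngP sY; rewrite msym_hsym // => k.
by rewrite !in_blocks; apply: eq_has => i; rewrite sY.
Qed.

Lemma hsym_block_inv nu i r : hsym (block N nu i) r \in young_inv nu.
Proof. by have := hsym_blocks_inv nu [:: i] r; rewrite /blocks big_seq1. Qed.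

Lemma disjoint_block nu i t :
  i \notin t -> [disjoint block N nu i & blocks nu t].
Proof.
move=> it; rewrite -setI_eq0; apply/eqP/setP => k; rewrite !inE -in_block in_blocks.
apply/andP => -[ki /hasP [j jt kj]].
by rewrite (block_inj ki kj) jt in it.
Qed.

(** Both sides are the coefficient of T^d in the product of the series of the blocks, truncated
    after degree d: distributing the product gives the left side, and repeated use of [hsymU] the
    right side. *)
Lemma hsym_blocksE nu t r : uniq t -> hsym_blocks K N nu t r = hsym (blocks nu t) r.
Proof.
case: r => // d ut; rewrite /hsym_blocks.
pose H (A : {set 'I_N}) : {poly Pol} := \poly_(q < d.+1) hsym A q%:Z.
have HE A q : (q <= d)%N -> (H A)`_q = hsym A q%:Z.
  by move=> le; rewrite coef_poly ltnS le.
suff /(_ d (leqnn d)) <- : forall q, (q <= d)%N ->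
    (\prod_(i <- t) H (block N nu i))`_q = hsym (blocks nu t) q%:Z.
  rewrite (big_nth 0%N) big_mkord.
  under [in RHS]eq_bigr do rewrite /H poly_def.
  rewrite bigA_distr_bigA coef_sum big_mkcond /=; apply: eq_bigr => a _.
  under [in RHS]eq_bigr do rewrite -mul_polyC.
  rewrite big_split /= prodrXr -rmorph_prod coefCM coefXn eq_sym.
  by case: eqP => _; rewrite ?mulr1 ?mulr0.
elim: t ut => [_|i t IH /= /andP [it ut]] q le.
  by rewrite /blocks !big_nil coef1 hsym_set0.
rewrite big_cons coefM /blocks big_cons -/(blocks nu t).
rewrite (@hsymU _ _ _ _ _ q.+1) ?disjoint_block //; last by lia.
apply: eq_bigr => k _; have kq : (k <= q)%N by rewrite -ltnS.
rewrite HE ?(leq_trans kq) // IH ?(leq_trans (leq_subr _ _)) //.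
by congr (_ * hsym _ _); lia.
Qed.

End YoungInvariants.

(** * The refined invariant ring is spanned by the powers of one variable *)

Section Spanning.

Variables (K : fieldType) (N : nat).
Local Notation Pol := {mpoly K[N]}.
Local Notation young_inv := (@young_inv K N).
Implicit Types (x : 'I_N) (f g : Pol).

Local Notation "m # s" := [multinom m (s i) | i < N]
  (at level 40, left associativity).

Lemma mcoeff_bounded (E : 'X_{1..N} -> K) (k : nat) :
  (forall m, (k <= mdeg m)%N -> E m = 0) ->
  forall m, (\sum_(m : 'X_{1..N < k}) E m *: 'X_[m])@_m = E m.
Proof.
move=> E0 m; have [lt|le] := ltnP (mdeg m) k; first exact: mcoeff_mpoly.
rewrite E0 // raddf_sum big1 // => m' _ /=.
rewrite mcoeffZ mcoeffX; case: eqP => [e|_]; last by rewrite mulr0.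
by move: le; rewrite -e leqNgt bmdeg.
Qed.

(* The part of [f] free of [X_x] determines an invariant of the larger group: *)
(* each of its monomials is moved along the block [b] so as to avoid some     *)
(* other variable.  Subtracting it leaves a multiple of [X_x].                *)
Lemma young_inv_span (mu rho : seq nat) (b : nat) x f :
  x \in block N mu b ->
  (forall s, (s \in young N rho) = (s \in young N mu) && (s x == x)) ->
  f \in young_inv rho ->
  exists2 qs : seq Pol, {subset qs <= young_inv mu} &
    f = \sum_(m < size qs) qs`_m * 'X_x ^+ m.
Proof.
move=> xY rhoE fr.
(* Induction on a strict degree bound: the quotient by X_x of what remains of [f] has a smaller
   one. *)
have [k] : exists k, forall m, (k <= mdeg m)%N -> f@_m = 0.
  by exists (msize f) => m le; apply/memN_msupp_eq0/msize_mdeg_ge.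
elim: k f fr => [|k IH] f fr fk.
  by exists [::] => //; rewrite big_ord0; apply/mpolyP => m; rewrite fk ?mcoeff0.
have fE s (m : 'X_{1..N}) : s \in young N mu -> s x = x -> f@_(m # s) = f@_m.
  move=> sY sx; rewrite -mcoeff_sym; congr (_@__).
  by move/young_invP: fr; apply; rewrite rhoE sY sx eqxx.
(* [E] is to agree with the coefficients of [f] on monomials free of X_x and to be invariant under
   the larger group. The value 0 occurs only when all variables of the block divide the monomial,
   hence only for multiples of X_x. *)
pose E (m : 'X_{1..N}) := if [pick y in block N mu b | m y == 0%N] is Some y
            then f@_(m # tperm x y) else 0.
have EE (m : 'X_{1..N}) z : z \in block N mu b -> m z = 0%N ->
    forall s, s \in young N mu -> forall y, y \in block N mu b -> m (s y) = 0%N ->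
    f@_(m # s # tperm x y) = f@_(m # tperm x z).
  move=> zY mz s sY y yY my.
  have syY : s y \in block N mu b by move/youngP: sY => ->.
  (* This permutation sends x through y, s y and z back to x, so it lies in the group of [rho]. The
     factor [tperm (s y) z] is harmless because both exponents are 0. Hence [E] does not depend on
     the variable picked. *)
  rewrite -[RHS](fE (tperm x y * s * tperm (s y) z * tperm x z)%g).
  - congr (_@__); apply/mnmP => i; rewrite !mnmE !permM tpermK.
    by case: (tpermP (s y) z) => [->|->|//]; rewrite ?mz ?my.
  - by rewrite !youngM // (young_tperm (i := b)).
  - by rewrite !permM tpermL tpermL tpermR.
have Es s (m : 'X_{1..N}) : s \in young N mu -> E (m # s) = E m.
  move=> sY; rewrite /E; case: pickP => [y /andP [yY]|nY].
    rewrite mnmE => /eqP my; case: pickP => [z /andP [zY /eqP mz]|/(_ (s y))].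
      exact: EE.
    by move/youngP: sY => ->; rewrite yY my.
  case: pickP => // z /andP [zY mz]; have := nY ((s^-1)%g z).
  by rewrite mnmE permKV mz -(youngP _ _ sY) permKV zY.
have Ex (m : 'X_{1..N}) : m x = 0%N -> E m = f@_m.
  move=> mx; rewrite /E; case: pickP => [y /andP [yY /eqP my]|/(_ x)]; last first.
    by rewrite xY mx.
  congr (_@__); apply/mnmP => i; rewrite mnmE.
  by case: tpermP => [->|->|//]; rewrite mx my.
have Ek (m : 'X_{1..N}) : (k.+1 <= mdeg m)%N -> E m = 0.
  by move=> le; rewrite /E; case: pickP => // y _; rewrite fk // mdeg_mperm.
pose F : Pol := \sum_(m : 'X_{1..N < k.+1}) E m *: 'X_[m].
have FE (m : 'X_{1..N}) : F@_m = E m by rewrite mcoeff_bounded.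
have FY : F \in young_inv mu.
  by apply/young_invP => s sY; apply/mpolyP => m; rewrite mcoeff_sym !FE Es.
pose g : Pol := \sum_(m : 'X_{1..N < k}) (f - F)@_(m + U_(x)) *: 'X_[m].
have gk (m : 'X_{1..N}) : (k <= mdeg m)%N -> (f - F)@_(m + U_(x)) = 0.
  by move=> le; rewrite mcoeffB FE fk ?Ek ?subr0 // mdegD mdeg1 addn1.
have gE (m : 'X_{1..N}) : g@_m = (f - F)@_(m + U_(x)) by rewrite (mcoeff_bounded gk).
have eqf : f = F + 'X_x * g.
  apply/mpolyP => m; rewrite mcoeffD mcoeffXM gE FE.
  have [/Ex ->|mx] := eqVneq (m x) 0%N; first by rewrite addr0.
  by rewrite submK ?lep1mP // mcoeffB FE addrC subrK.
have [||qs qsY eqg] := IH g.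
- apply/young_invP => s; rewrite rhoE => /andP [sY /eqP sx].
  apply/mpolyP => m; rewrite mcoeff_sym !gE !mcoeffB !FE.
  have -> : (m # s + U_(x))%MM = (m + U_(x))%MM # s.
    by apply/mnmP => i; rewrite !mnmE -{2}sx (inj_eq perm_inj).
  by rewrite Es // fE.
- by move=> m /gk; rewrite gE.
exists (F :: qs); first by move=> q; rewrite inE => /predU1P [->|/qsY].
rewrite eqf big_ord_recl /= mulr1; congr (_ + _).
rewrite {1}eqg mulr_sumr; apply: eq_bigr => m _.
by rewrite exprS mulrCA.
Qed.

End Spanning.

(** * The ideal and the moved variable *)

Section IdealTheory.

Variables (K : fieldType) (N : nat).
Local Notation Pol := {mpoly K[N]}.
Local Notation hsym := (@hsym K N).
Local Notation esym := (@Defs.esym K N).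
Local Notation young_inv := (@young_inv K N).
Implicit Types (la nu t : seq nat) (f g : Pol) (r : int).

(* Taking the coefficient of [T ^ (d + D)] in [H_U H_B / H_A], the last sum   *)
(* collects the terms whose degree in [U] exceeds [d].                        *)
Lemma hsym_setD_split (U B A : {set 'I_N}) (d M E : nat) (D : int) :
  [disjoint U & B] -> A \subset U -> (#|A| < M)%N -> D <= E%:Z ->
  let G z := \sum_(l < M) (-1) ^+ l * esym A l * hsym B (z - (l : nat)%:Z) in
  hsym ((U :|: B) :\: A) (d%:Z + D) =
    \sum_(s < d.+1) hsym U (d%:Z - s%:Z) * G (D + s%:Z) +
    \sum_(q < E) hsym U (d.+1 + q)%N%:Z * G (D - 1 - q%:Z).
Proof.
move=> dUB sAU cA DE G.
have sAUB : A \subset U :|: B by apply: subset_trans sAU (subsetUl _ _).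
rewrite -(sum_esym_hsym K _ sAUB cA).
(* The full convolution, with q the degree in [U]; [D <= E] ensures that no degree up to d + D is
   missed. It is then cut at q = d. *)
transitivity (\sum_(q < d.+1 + E) hsym U q%:Z * G (d%:Z + D - q%:Z)).
  rewrite /G; under [RHS]eq_bigr do rewrite mulr_sumr.
  rewrite exchange_big /=; apply: eq_bigr => l _.
  rewrite (hsymU (M := d.+1 + E) _ dUB); last by lia.
  rewrite mulr_sumr; apply: eq_bigr => q _; rewrite mulrCA.
  by congr (_ * (_ * hsym _ _)); lia.
rewrite big_split_ord /=; congr (_ + _); last first.
  by apply: eq_bigr => q _; congr (_ * G _); lia.
rewrite (reindex_inj rev_ord_inj) /=; apply: eq_bigr => q _.
have := ltn_ord q; rewrite ltnS => qd.
by congr (hsym _ _ * G _); lia.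
Qed.

Lemma Ideal0 la nu : Ideal la nu (0 : Pol).
Proof. by exists [::]; rewrite big_nil. Qed.

Lemma IdealD la nu f g : Ideal la nu f -> Ideal la nu g -> Ideal la nu (f + g).
Proof.
move=> [ps [hps ->]] [qs [hqs ->]]; exists (ps ++ qs); rewrite big_cat.
by split=> // p; rewrite mem_cat => /orP [/hps|/hqs].
Qed.

Lemma IdealM la nu f g : f \in young_inv nu -> Ideal la nu g -> Ideal la nu (f * g).
Proof.
move=> fY [ps [hps ->]]; exists [seq (f * p.1, p.2) | p <- ps].
split=> [_ /mapP [p /hps [pY pg] ->]|]; first by split; rewrite ?rpredM.
by rewrite big_map mulr_sumr; apply: eq_bigr => p _; rewrite mulrA.
Qed.

Lemma IdealZ la nu (c : K) f : Ideal la nu f -> Ideal la nu (c *: f).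
Proof.
by move=> fI; rewrite -[f]mul1r scalerAl; apply: IdealM; rewrite ?young_invZ ?rpred1.
Qed.

Lemma Ideal_sum la nu k (F : 'I_k -> Pol) :
  (forall i, Ideal la nu (F i)) -> Ideal la nu (\sum_(i < k) F i).
Proof.
by move=> h; elim/big_ind: _ => // [|f g]; [apply: Ideal0 | apply: IdealD].
Qed.

Definition gen_bound la nu t : int :=
  (sumn (take (size t) la))%:Z - (\sum_(i <- t) nth 0%N nu i)%N%:Z.

(** Generators are indexed by increasing lists, but exchanging one block for another spoils the
    order. Sorting shows that distinctness suffices. *)
Lemma Ideal_hsym la nu t r :
  t != [::] -> uniq t -> all (fun i => i < size nu)%N t -> gen_bound la nu t < r ->
  Ideal la nu (hsym (blocks N nu t) r).
Proof.
move=> t0 ut st lt; pose t' := sort leq t.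
have pt : perm_eq t' t by rewrite perm_sort.
have ut' : uniq t' by rewrite sort_uniq.
exists [:: (1, hsym (blocks N nu t) r)]; rewrite big_seq1 mul1r; split=> // p.
rewrite inE => /eqP ->; split; first exact: rpred1.
exists t', r; split.
- by rewrite -size_eq0 size_sort size_eq0.
- by rewrite ltn_sorted_uniq_leq ut' sort_sorted //; apply: leq_total.
- by rewrite (perm_all _ pt).
- by rewrite (perm_size pt) (perm_big _ pt).
- by rewrite hsym_blocksE // /blocks (perm_big _ pt).
Qed.

End IdealTheory.

(** * One variable moving between two blocks, treated uniformly for both operators *)

Section MoveVariable.

Variables (K : fieldType) (N : nat).
Local Notation Pol := {mpoly K[N]}.
Local Notation hsym := (@hsym K N).
Local Notation esym := (@Defs.esym K N).
Local Notation young_inv := (@young_inv K N).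

(** The variable [x] leaves block [a] of [nu] and joins block [b] of [mu]; the Young subgroup of
    [rho] is the stabilizer of [x] in that of [mu]. For E the pair ([a], [b]) is (i+1, i), for F it
    is (i, i+1). *)
Variables (la nu mu rho : seq nat) (a b : nat) (x : 'I_N).
Hypothesis size_mu : size mu = size nu.
Hypothesis b_lt : (b < size nu)%N.
Hypothesis ab : a != b.
Hypothesis x_nu : x \in block N nu a.
Hypothesis x_mu : x \in block N mu b.
Hypothesis block_mu :
  forall i (k : 'I_N), k != x -> (k \in block N mu i) = (k \in block N nu i).
Hypothesis nth_mu :
  forall i, (nth 0 mu i + (i == a) = nth 0 nu i + (i == b))%N.
Hypothesis young_rho :
  forall s, (s \in young N rho) = (s \in young N mu) && (s x == x).

Lemma mem_block_x_nu i : (x \in block N nu i) = (i == a).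
Proof. by apply/idP/eqP => [/block_inj|->//]; apply. Qed.

Lemma mem_block_x_mu i : (x \in block N mu i) = (i == b).
Proof. by apply/idP/eqP => [/block_inj|->//]; apply. Qed.

Lemma young_rho_nu s : s \in young N rho -> s \in young N nu.
Proof.
rewrite young_rho => /andP [/youngP sY /eqP sx]; apply/youngP => i k.
have [->|kx] := eqVneq k x; first by rewrite sx.
have skx : s k != x by rewrite -[X in _ != X]sx (inj_eq perm_inj).
by rewrite -!block_mu.
Qed.

Lemma young_inv_nu_rho : {subset young_inv nu <= young_inv rho}.
Proof.
by move=> f /young_invP fY; apply/young_invP => s /young_rho_nu; apply: fY.
Qed.

Lemma young_inv_mu_rho : {subset young_inv mu <= young_inv rho}.
Proof.
move=> f /young_invP fY; apply/young_invP => s; rewrite young_rho => /andP [sY _].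
exact: fY.
Qed.

Lemma X_rho : ('X_x : Pol) \in young_inv rho.
Proof.
apply/young_invP => s; rewrite young_rho => /andP [_ /eqP sx].
by rewrite msymXU sx.
Qed.

Lemma blocks_move t k : k != x -> (k \in blocks N mu t) = (k \in blocks N nu t).
Proof. by move=> kx; rewrite !in_blocks; apply: eq_has => i; rewrite block_mu. Qed.

Lemma mem_blocks_nu t : (x \in blocks N nu t) = (a \in t).
Proof.
rewrite in_blocks -has_pred1; apply: eq_has => i; exact: mem_block_x_nu.
Qed.

Lemma mem_blocks_mu t : (x \in blocks N mu t) = (b \in t).
Proof.
rewrite in_blocks -has_pred1; apply: eq_has => i; exact: mem_block_x_mu.
Qed.

Lemma blocks_same t : (a \in t) = (b \in t) -> blocks N nu t = blocks N mu t.
Proof.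
move=> e; apply/setP => k; have [->|kx] := eqVneq k x.
  by rewrite mem_blocks_nu mem_blocks_mu.
by rewrite blocks_move.
Qed.

Lemma blocks_gain t : b \in t -> blocks N mu t = x |: blocks N nu t.
Proof.
move=> bt; apply/setP => k; rewrite in_setU1; have [->|kx] := eqVneq k x.
  by rewrite mem_blocks_mu.
by rewrite blocks_move.
Qed.

Lemma blocks_lose t : a \in t -> blocks N nu t = x |: blocks N mu t.
Proof.
move=> bt; apply/setP => k; rewrite in_setU1; have [->|kx] := eqVneq k x.
  by rewrite mem_blocks_nu.
by rewrite blocks_move.
Qed.

Lemma sum_mu (t : seq nat) : uniq t ->
  (\sum_(i <- t) nth 0 mu i + (a \in t) = \sum_(i <- t) nth 0 nu i + (b \in t))%N.
Proof.
move=> ut.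
have c1 c : (c \in t : nat) = (\sum_(i <- t) (i == c))%N.
  rewrite -(count_uniq_mem c ut) -sum1_count big_mkcond.
  by apply: eq_bigr => i _ /=; case: eqP.
by rewrite !c1 -!big_split; apply: eq_bigr => i _; apply: nth_mu.
Qed.

Variable Phi : Pol -> Pol.
Variables (c : K) (j : nat).
Hypothesis Phi_linear : linear_map_from_to (young_inv rho) (young_inv mu) Phi.
Hypothesis PhiX : forall m : nat,
  Phi ('X_x ^+ m) =
    c *: \sum_(l < nth 0%N nu a)
      (-1) ^+ l * esym_block K N mu a l *
      hsym_block K N mu b
        (m%:Z + j%:Z + (nth 0%N nu a)%:Z - (nth 0%N nu b)%:Z - 1 - (l : nat)%:Z).

Lemma Phi0 : Phi 0 = 0.
Proof.
have [_ /(_ 1 0 0)] := Phi_linear; rewrite !rpred0 rpred1 mul1r add0r mul1r.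
by move=> /(_ isT isT isT) /eqP; rewrite eq_sym -subr_eq0 addrK => /eqP.
Qed.

Lemma Phi_sum k (q f : 'I_k -> Pol) :
  (forall i, q i \in young_inv mu) -> (forall i, f i \in young_inv rho) ->
  Phi (\sum_(i < k) q i * f i) = \sum_(i < k) q i * Phi (f i).
Proof.
move=> qY fY; have [_ lin] := Phi_linear.
elim: k q f qY fY => [|k IH] q f qY fY; first by rewrite !big_ord0 Phi0.
rewrite !big_ord_recl lin ?IH //.
by apply: rpred_sum => i _; rewrite rpredM // young_inv_mu_rho.
Qed.

Lemma PhiX_mu m : Phi ('X_x ^+ m) \in young_inv mu.
Proof. by have [h _] := Phi_linear; rewrite h // rpredX // X_rho. Qed.

Lemma PhiM q f : q \in young_inv mu -> f \in young_inv rho ->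
  Phi (q * f) = q * Phi f.
Proof.
move=> qY fY; have [_ lin] := Phi_linear.
by rewrite -[q * f]addr0 lin ?rpred0 // Phi0 addr0.
Qed.

Lemma Ideal_move_same (t : seq nat) (r : int) (m : nat) :
  t != [::] -> uniq t -> all (fun i => i < size nu)%N t -> gen_bound la nu t < r ->
  (a \in t) = (b \in t) ->
  Ideal la mu (Phi ('X_x ^+ m * hsym (blocks N nu t) r)).
Proof.
move=> t0 ut st lt abt; rewrite mulrC blocks_same // PhiM ?hsym_blocks_inv //; last first.
  by rewrite rpredX // X_rho.
rewrite mulrC; apply: IdealM; first exact: PhiX_mu.
apply: Ideal_hsym; rewrite ?size_mu //.
by move: lt; rewrite /gen_bound; have := sum_mu ut; rewrite abt => /addIn ->.
Qed.

Lemma Ideal_move_gain (t : seq nat) (r : int) (m : nat) :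
  t != [::] -> uniq t -> all (fun i => i < size nu)%N t -> gen_bound la nu t < r ->
  a \notin t -> b \in t ->
  Ideal la mu (Phi ('X_x ^+ m * hsym (blocks N nu t) r)).
Proof.
move=> t0 ut st lt at0 bt.
have xN : x \notin blocks N nu t by rewrite mem_blocks_nu.
(* The union has one more variable in [mu] than in [nu], so the threshold drops by one and r - 1 is
   still above it. *)
have gen (r' : int) : r - 1 <= r' -> Ideal la mu (hsym (blocks N mu t) r').
  move=> le; apply: Ideal_hsym; rewrite ?size_mu //; move: lt; rewrite /gen_bound.
  by have := sum_mu ut; rewrite bt (negbTE at0) addn0 addn1 => ->; lia.
have -> : 'X_x ^+ m * hsym (blocks N nu t) r =
    hsym (blocks N mu t) r * 'X_x ^+ m + - hsym (blocks N mu t) (r - 1) * 'X_x ^+ m.+1.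
  have := hsymU1 K r xN; rewrite -blocks_gain // => -> //.
  by rewrite exprS; ring.
have [_ lin] := Phi_linear; have XY k := rpredX k X_rho.
rewrite lin ?PhiM ?rpredN ?rpredM ?hsym_blocks_inv //; last first.
  by rewrite young_inv_mu_rho // rpredN hsym_blocks_inv.
rewrite mulrC; apply: IdealD; first by apply: IdealM; [apply: PhiX_mu | apply: gen; lia].
rewrite mulrC mulrN -mulNr; apply: IdealM; first by rewrite rpredN PhiX_mu.
exact: gen.
Qed.

Lemma Ideal_move_lose (t : seq nat) (r : int) (m : nat) :
  t != [::] -> uniq t -> all (fun i => i < size nu)%N t -> gen_bound la nu t < r ->
  a \in t -> b \notin t ->
  Ideal la mu (Phi ('X_x ^+ m * hsym (blocks N nu t) r)).
Proof.
move=> t0 ut st lt at1 bt; have XY k := rpredX k X_rho.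
(* [T] indexes the blocks that make up (U + B) - A, with as many blocks as [t]. *)
set T := b :: rem a t.
have uT : uniq T by rewrite /= rem_uniq // andbT; apply: contra bt; apply: mem_rem.
have aT : a \notin T by rewrite inE negb_or ab mem_rem_uniqF.
have sE := perm_size (perm_to_rem at1).
have nE : (\sum_(i <- T) nth 0 mu i + nth 0 nu a = (\sum_(i <- t) nth 0 nu i) + (nth 0 nu b).+1)%N.
  rewrite big_cons (perm_big _ (perm_to_rem at1)) big_cons /=.
  have := sum_mu (rem_uniq a ut); have /negbTE -> : b \notin rem a t by case/andP: uT.
  rewrite mem_rem_uniqF // !addn0 => ->.
  have := nth_mu b; rewrite eqxx eq_sym (negbTE ab) addn0 addn1 => ->.
  by rewrite addnC [((nth 0 nu b).+1 + _)%N]addnC addnA.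
have [r0|] := ltrP r 0; first by rewrite hsym_lt0 // mulr0 Phi0; apply: Ideal0.
case: r lt => // d lt _.
(* With this shift, [Phi] sends x^(m+s) to c times the coefficient of T^(D+s) in H_B/H_A. The
   threshold of [T] in [mu] is that of [t] in [nu] plus nu_a - nu_b - 1, which is at most [D]
   more. *)
set D : int := m%:Z + j%:Z + (nth 0%N nu a)%:Z - (nth 0%N nu b)%:Z - 1.
have ltT : gen_bound la mu T < d%:Z + D.
  by move: lt nE; rewrite /gen_bound sE /= /D; lia.
set U := blocks N mu t.
have xU : x \notin U by rewrite mem_blocks_mu.
(* Losing [x] raises the threshold by one, so degree d itself may fail, but all higher degrees give
   generators. *)
have genU (r : int) : d%:Z < r -> Ideal la mu (hsym U r).
  move=> le; apply: Ideal_hsym; rewrite ?size_mu //; move: lt; rewrite /gen_bound.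
  by have := sum_mu ut; rewrite at1 (negbTE bt) addn0 addn1 => <-; lia.
rewrite blocks_lose // (hsymU1_sum (M := d.+1) _ xU); last by lia.
rewrite mulr_sumr.
under eq_bigr => s _ do rewrite mulrA -exprD mulrC.
rewrite Phi_sum //; last by move=> s; rewrite hsym_blocks_inv.
under eq_bigr => s _ do rewrite PhiX -scalerAr.
rewrite -scaler_sumr; apply: IdealZ.
set A := block N mu a; set B := block N mu b.
pose G z := \sum_(l < nth 0%N nu a) (-1) ^+ l * esym A l * hsym B (z - (l : nat)%:Z).
have GY z : G z \in young_inv mu.
  rewrite rpred_sum // => l _; rewrite rpredM ?hsym_block_inv //.
  by rewrite rpredM ?esym_block_inv // rpredX // rpredN rpred1.
have UE : U = A :|: blocks N mu (rem a t).
  by rewrite /U /blocks (perm_big _ (perm_to_rem at1)) big_cons.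
have dUB : [disjoint U & B] by rewrite disjoint_sym disjoint_block.
have cA : (#|A| < nth 0%N nu a)%N.
  apply: leq_ltn_trans (card_block _ _ _) _.
  by have := nth_mu a; rewrite eqxx (negbTE ab) addn0 addn1 => <-.
have sAU : A \subset U by rewrite UE subsetUl.
(* [D] may be negative, so its absolute value bounds the length of the tail. *)
have := hsym_setD_split K d dUB sAU cA (lez_abs D).
have -> : (U :|: B) :\: A = blocks N mu T.
  rewrite UE /T [blocks N mu (_ :: _)]/blocks big_cons -/(blocks _ _ _) -setUA setDUl setDv set0U.
  rewrite setUC; apply/setDidPl; rewrite disjoint_sym.
  by have := disjoint_block N mu aT; rewrite {1}/blocks big_cons.
move=> /= eqT; have -> : \sum_(s < d.+1) hsym U (d%:Z - s%:Z) *
    \sum_(l < nth 0%N nu a) (-1) ^+ l * esym_block K N mu a l * hsym_block K N mu b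
        ((m + s)%N%:Z + j%:Z + (nth 0%N nu a)%:Z - (nth 0%N nu b)%:Z - 1 - (l : nat)%:Z) =
    hsym (blocks N mu T) (d%:Z + D) +
    \sum_(q < `|D|%N) (- G (D - 1 - q%:Z)) * hsym U (d.+1 + q)%N%:Z.
  rewrite eqT -addrA -big_split /= [X in _ + X]big1 ?addr0; last first.
    by move=> q _; rewrite mulNr mulrC subrr.
  apply: eq_bigr => s _; congr (_ * _); apply: eq_bigr => l _.
  by congr (_ * hsym _ _); rewrite /D; lia.
apply: IdealD; last first.
  apply: Ideal_sum => q; apply: IdealM; first by rewrite rpredN GY.
  by apply: genU; rewrite ltz_nat ltnS leq_addr.
apply: Ideal_hsym => //.
by rewrite size_mu /= b_lt; apply/allP => i /mem_rem; apply: (allP st).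
Qed.

Lemma Ideal_move f : Ideal la nu f -> Ideal la mu (Phi f).
Proof.
case=> ps [hps ->]; have [_ lin] := Phi_linear.
elim: ps hps => [|[p g] ps IH] hps; first by rewrite big_nil Phi0; apply: Ideal0.
have hps' q : q \in ps -> q.1 \in young_inv nu /\ ideal_gens la nu q.2.
  by move=> qps; apply: hps; rewrite inE qps orbT.
have [/= pY [t [r [t0 st lt_t lt ->]]]] := hps _ (mem_head _ _).
have ut : uniq t by move: st; rewrite ltn_sorted_uniq_leq => /andP [].
have gensY q : ideal_gens la nu q -> q \in young_inv rho.
  move=> [t1 [r1 [_ st1 _ _ ->]]]; apply: young_inv_nu_rho.
  by move: st1; rewrite ltn_sorted_uniq_leq => /andP [ut1 _]; rewrite hsym_blocksE ?hsym_blocks_inv.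
rewrite big_cons /= hsym_blocksE //; set h := hsym _ r.
have hY : h \in young_inv rho by apply/young_inv_nu_rho/hsym_blocks_inv.
have phY : p * h \in young_inv rho by rewrite rpredM // young_inv_nu_rho.
have psY : \sum_(q <- ps) q.1 * q.2 \in young_inv rho.
  rewrite big_seq rpred_sum // => q /hps' [qY /gensY gY].
  have qY' := young_inv_nu_rho qY.
  exact: rpredM qY' gY.
rewrite -[p * h]mul1r lin ?rpred1 //.
rewrite mul1r; apply: IdealD; last exact: IH.
(* The coefficient p lies in P_nu, over which [Phi] need not be linear. Rewriting it over P_mu
   leaves only powers of [x] times the generator. *)
have [qs qsY ->] := young_inv_span x_mu young_rho (young_inv_nu_rho pY).
rewrite mulr_suml; under eq_bigr => m _ do rewrite -mulrA.
have qY (m : 'I_(size qs)) : qs`_m \in young_inv mu by rewrite qsY ?mem_nth.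
rewrite Phi_sum //; last by move=> m; rewrite rpredM // rpredX // X_rho.
apply: Ideal_sum => m; apply: IdealM => //.
case: (boolP (a \in t)) (boolP (b \in t)) => [at1|at0] [bt1|bt0].
- by apply: Ideal_move_same => //; rewrite at1 bt1.
- exact: Ideal_move_lose.
- exact: Ideal_move_gain.
- by apply: Ideal_move_same => //; rewrite (negbTE at0) (negbTE bt0).
Qed.

End MoveVariable.

(** * The compositions nu + alpha_i and nu - alpha_i *)

Section MovedCompositions.

Variable N : nat.
Implicit Types (nu : seq nat) (i k : nat).

Lemma nth_add_alpha nu i k : (i.+1 < size nu)%N ->
  nth 0%N (add_alpha nu i) k = (nth 0 nu k + (k == i) - (k == i.+1))%N.
Proof.
move=> lt; have [ltk|lek] := ltnP k (size nu); first by rewrite nth_mkseq.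
by rewrite !nth_default ?size_mkseq //; lia.
Qed.

Lemma nth_add_alphaD nu i k : (i.+1 < size nu)%N -> (0 < nth 0 nu i.+1)%N ->
  (nth 0 (add_alpha nu i) k + (k == i.+1) = nth 0 nu k + (k == i))%N.
Proof.
move=> lt gt0; rewrite nth_add_alpha //; have [->|_] := eqVneq k i.+1; last by lia.
by rewrite gtn_eqF //; lia.
Qed.

Lemma nth_sub_alpha nu i k : (i.+1 < size nu)%N ->
  nth 0%N (sub_alpha nu i) k = (nth 0 nu k + (k == i.+1) - (k == i))%N.
Proof.
move=> lt; have [ltk|lek] := ltnP k (size nu); first by rewrite nth_mkseq.
by rewrite !nth_default ?size_mkseq //; lia.
Qed.

(** This lets F on [nu] be studied through the pair formed by mu = nu - alpha_i and mu + alpha_i,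
    which is the pair for E read backwards. *)
Lemma sub_alphaK nu i : (i.+1 < size nu)%N -> (0 < nth 0 nu i)%N ->
  add_alpha (sub_alpha nu i) i = nu.
Proof.
move=> lt gt0; apply: (@eq_from_nth _ 0%N); rewrite ?size_mkseq // => k _.
rewrite nth_add_alpha ?size_mkseq // nth_sub_alpha //.
have [->|_] := eqVneq k i; last by case: eqP; lia.
by rewrite ltn_eqF // addn0 subn0; lia.
Qed.

Lemma sumn_take_add_alpha nu i k : (i.+1 < size nu)%N -> (0 < nth 0 nu i.+1)%N ->
  sumn (take k (add_alpha nu i)) = (sumn (take k nu) + (k == i.+1))%N.
Proof.
move=> lt gt0; elim: k => [|k IH]; first by rewrite !take0.
rewrite !sumn_takeS IH nth_add_alpha // eqSS.
have [->|_] := eqVneq k i.+1; last by rewrite addn0 subn0 addnA.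
by rewrite gtn_eqF //; lia.
Qed.

Lemma nth_refine_add nu i k : (i.+1 < size nu)%N ->
  nth 0%N (refine_add nu i) k =
    if (k <= i)%N then nth 0%N nu k else
    if k == i.+1 then 1%N else (nth 0 nu k.-1 - (k == i.+2))%N.
Proof.
move=> lt; rewrite /refine_add nth_cat size_take lt ltnS.
case: leqP => [le|ik]; first by rewrite nth_take.
case: k ik => // k; rewrite ltnS subSS eqSS => ik.
rewrite -(subnK ik) addnK; case: (k - i)%N => [|[|p]] /=; first by rewrite eqxx.
  by rewrite add1n eqxx gtn_eqF // subn1.
rewrite nth_drop !gtn_eqF ?subn0; [|lia|lia].
by congr nth; lia.
Qed.

Lemma sumn_take_refine_add nu i k : (i.+1 < size nu)%N -> (0 < nth 0 nu i.+1)%N ->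
  sumn (take k (refine_add nu i)) =
    if (k <= i.+1)%N then sumn (take k nu) else (sumn (take k.-1 nu) + (k == i.+2))%N.
Proof.
move=> lt gt0; elim: k => [|k IH]; first by rewrite !take0.
rewrite sumn_takeS IH nth_refine_add // ltnS.
have [le|gt] := leqP k i; first by rewrite leqW // sumn_takeS.
have [->|ne] := eqVneq k i.+1; first by rewrite leqnn eqxx.
have {ne}gt' : (i.+1 < k)%N by rewrite ltn_neqAle eq_sym ne.
rewrite [(k <= i.+1)%N]leqNgt gt' /=; case: k {IH gt} gt' => // k; rewrite ltnS /= !eqSS => gt.
rewrite (sumn_takeS nu k) (gtn_eqF gt) addn0.
by have [->|_] := eqVneq k i.+1; lia.
Qed.

(** The refinement splits off [x], the first variable of block i+1, as a block of its own and shifts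
    the later indices by one. The condition [y != x] matters only for k = i+2; further blocks of
    [nu] do not contain [x]. *)
Lemma block_refine_add nu i k (x y : 'I_N) :
  (i.+1 < size nu)%N -> (0 < nth 0 nu i.+1)%N -> x = block_end nu i :> nat ->
  (y \in block N (refine_add nu i) k) =
    if (k <= i)%N then y \in block N nu k else
    if k == i.+1 then y == x else (y != x) && (y \in block N nu k.-1).
Proof.
move=> lt gt0 xE; rewrite !in_block !sumn_take_refine_add // -!(inj_eq val_inj) /= xE.
rewrite /block_end ltnS.
have [le|gt] := leqP k i; first by rewrite leqW.
have [->|ne] := eqVneq k i.+1; first by rewrite leqnn eqxx addn1 ltnS eqn_leq andbC.
have {ne}gt' : (i.+1 < k)%N by rewrite ltn_neqAle eq_sym ne.
rewrite [(k <= i.+1)%N]leqNgt gt' /=; case: k {gt} gt' => // k; rewrite ltnS /= !eqSS => gt.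
rewrite (gtn_eqF gt) addn0; have [->|ne] := eqVneq k i.+1; first by lia.
have gt' : (i.+1 < k)%N by rewrite ltn_neqAle eq_sym ne.
by have := leq_sumn_take nu gt'; rewrite (sumn_takeS nu i.+1); lia.
Qed.

Section Pair.

Variables (nu : seq nat) (i : nat) (x : 'I_N).
Hypothesis lt_i : (i.+1 < size nu)%N.
Hypothesis gt0_nu : (0 < nth 0 nu i.+1)%N.
Hypothesis xE : x = block_end nu i :> nat.

Lemma add_alpha_x_old : x \in block N nu i.+1.
Proof. by rewrite in_block xE /block_end leqnn (sumn_takeS nu i.+1) -addn1 leq_add2l. Qed.

Lemma add_alpha_x_new : x \in block N (add_alpha nu i) i.
Proof.
rewrite in_block xE /block_end !sumn_take_add_alpha // eqxx addn1 ltnSn andbT.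
by rewrite ltn_eqF // addn0 leq_sumn_take.
Qed.

Lemma block_add_alpha k y : y != x ->
  (y \in block N (add_alpha nu i) k) = (y \in block N nu k).
Proof.
rewrite -(inj_eq val_inj) /= xE /block_end => yx.
rewrite !in_block !sumn_take_add_alpha // eqSS.
have := leq_sumn_take nu (leqnSn k).
have [->|_] := eqVneq k i; first by rewrite ltn_eqF //; lia.
by have [e|_] := eqVneq k i.+1; rewrite ?e; lia.
Qed.

Lemma young_refine_add s :
  (s \in young N (refine_add nu i)) = (s \in young N nu) && (s x == x).
Proof.
have bE := block_refine_add _ _ lt_i gt0_nu xE.
apply/youngP/andP => [sR|[/youngP sY /eqP sx] k y]; last first.
  have sE : (s y == x) = (y == x) by rewrite -[X in s y == X]sx (inj_eq perm_inj).
  by rewrite !bE !sY sE.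
have sx : s x = x.
  by apply/eqP; have := sR i.+1 x; rewrite !bE ltnn !eqxx.
split; last by rewrite sx.
apply/youngP => k y; have [->|yx] := eqVneq y x; first by rewrite sx.
have [le|gt] := leqP k i; first by have := sR k y; rewrite !bE le.
have := sR k.+1 y; rewrite !bE leqNgt ltnS ltnW //= eqSS gtn_eqF // yx.
by rewrite -[X in s y != X]sx (inj_eq perm_inj) yx.
Qed.

(** A permutation fixing [x] preserves the blocks of [nu] exactly when it preserves those of nu +
    alpha_i, since these differ only in where [x] lies. So the refinement serves both
    compositions. *)
Lemma young_refine_add_new s :
  (s \in young N (refine_add nu i)) = (s \in young N (add_alpha nu i)) && (s x == x).
Proof.
rewrite young_refine_add; case: eqP => [sx|]; rewrite ?andbF // !andbT.
have sN y : y != x -> s y != x by rewrite -[X in s y != X]sx (inj_eq perm_inj).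
apply/youngP/youngP => h k y; have [->|yx] := eqVneq y x; rewrite ?sx //.
  by rewrite !block_add_alpha ?sN.
by rewrite -!block_add_alpha ?sN.
Qed.

End Pair.

Lemma refine_subE nu i : (i.+1 < size nu)%N -> (0 < nth 0 nu i)%N ->
  refine_sub nu i = refine_add (sub_alpha nu i) i.
Proof.
move=> lt gt0; have lt' : (i.+1 < size (sub_alpha nu i))%N by rewrite size_mkseq.
have ltW : (i < size nu)%N by apply: ltnW.
apply: (@eq_from_nth _ 0%N) => [|k _].
  rewrite /refine_sub /refine_add !size_cat /= !size_drop !size_take size_mkseq lt ltW; lia.
rewrite nth_refine_add // !nth_sub_alpha // /refine_sub nth_cat size_take ltW.
have [ki|ki|->] := ltngtP k i.
- by rewrite nth_take // (ltn_eqF (leqW ki)) addn0 subn0.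
- case: k ki => // k; rewrite ltnS eqSS /= => ki.
  rewrite -(subnK ki) -addSn addnK; case: (k - i)%N => [|[|p]] /=.
  + by rewrite eqxx.
  + by rewrite nth_drop addn0 add1n add2n !eqxx gtn_eqF // subn0 addnK.
  + rewrite nth_drop !gtn_eqF ?subn0 ?addn0; [|lia..].
    by congr nth; lia.
by rewrite subnn /= ltn_eqF // addn0 subn1.
Qed.

End MovedCompositions.

(** * The operators E and F as instances of the moving variable *)

Section Main.

Variables (K : fieldType) (N : nat).

Lemma varE (x : 'I_N) : var K N x = 'X_x.
Proof. by rewrite /var valK. Qed.

Lemma block_end_lt nu i : sumn nu = N -> (0 < nth 0 nu i.+1)%N ->
  (block_end nu i < N)%N.
Proof.
move=> <- gt0; rewrite /block_end -[X in (_ < sumn X)%N](cat_take_drop i.+2 nu).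
by rewrite sumn_cat (sumn_takeS nu i.+1) -addnA -addn1 leq_add2l addn_gt0 gt0.
Qed.

Lemma Ideal_E (la nu : seq nat) (c : K) (i j : nat) (Phi : {mpoly K[N]} -> {mpoly K[N]}) :
  sumn nu = N -> (i.+1 < size nu)%N -> (0 < nth 0 nu i.+1)%N ->
  extends_E c nu i j Phi -> forall f, Ideal la nu f -> Ideal la (add_alpha nu i) (Phi f).
Proof.
move=> sN lt_i gt0 [lin PhiX] f; pose x := Ordinal (block_end_lt sN gt0).
have xE : x = block_end nu i :> nat by [].
apply: (@Ideal_move _ _ la nu _ (refine_add nu i) i.+1 i x _ _ _ _ _ _ _ _ Phi c j) => //.
- by rewrite size_mkseq.
- exact: ltnW.
- by rewrite gtn_eqF.
- exact: add_alpha_x_old.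
- exact: add_alpha_x_new.
- by move=> k y; apply: block_add_alpha.
- by move=> k; rewrite nth_add_alphaD.
- by move=> s; apply: young_refine_add_new.
- by move=> m; rewrite -PhiX -xE varE.
Qed.

Lemma Ideal_F (la nu : seq nat) (c : K) (i j : nat) (Phi : {mpoly K[N]} -> {mpoly K[N]}) :
  sumn nu = N -> (i.+1 < size nu)%N -> (0 < nth 0 nu i)%N ->
  extends_F c nu i j Phi -> forall f, Ideal la nu f -> Ideal la (sub_alpha nu i) (Phi f).
Proof.
move=> sN lt_i gt0 [lin PhiX] f; set mu := sub_alpha nu i.
have size_mu : size mu = size nu by rewrite size_mkseq.
have lt_mu : (i.+1 < size mu)%N by rewrite size_mu.
have nuE : add_alpha mu i = nu by apply: sub_alphaK.
have gt0_mu : (0 < nth 0 mu i.+1)%N.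
  by rewrite nth_sub_alpha // eqxx gtn_eqF // subn0 addn1.
(* The last variable of block i of [nu] is thus the first variable of block i+1 of [mu], as the
   lemmas on mu + alpha_i require. *)
have endE : block_end nu i = (block_end mu i).+1.
  by rewrite /block_end -{1}nuE sumn_take_add_alpha // eqxx addn1.
have ltN : (block_end mu i < N)%N.
  rewrite -endE -sN /block_end -[X in (_ <= sumn X)%N](cat_take_drop i.+1 nu).
  by rewrite sumn_cat leq_addr.
pose x := Ordinal ltN; have xE : x = block_end mu i :> nat by [].
apply: (@Ideal_move _ _ la nu _ (refine_sub nu i) i i.+1 x _ _ _ _ _ _ _ _ Phi c^-1 j) => //.
- by rewrite ltn_eqF.
- by rewrite -nuE; apply: add_alpha_x_new.
- exact: add_alpha_x_old.
- by move=> k y yx; rewrite -[in RHS]nuE (block_add_alpha lt_mu gt0_mu xE).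
- by move=> k; rewrite -[X in (_ = nth 0 X k + _)%N]nuE nth_add_alphaD.
- by move=> s; rewrite refine_subE //; apply: young_refine_add.
- by move=> m; rewrite -PhiX endE -xE varE.
Qed.

End Main.

Theorem proposition5p4p2 (R : realType) (n N : nat) (hn : (2 <= n)%N)
    (hN : (1 <= N)%N) (la : n.-tuple nat) (hla : is_partition N la)
    (c : nat -> n.-tuple nat -> R[i])
    (hc : forall i nu, c i nu != 0)
    (nu : n.-tuple nat) (hnu : is_composition N nu)
    (i j : nat) (hi : (i.+1 < n)%N) (Phi : {mpoly R[i][N]} -> {mpoly R[i][N]}) :
  ((0 < nth 0%N nu i.+1)%N -> extends_E (c i nu) nu i j Phi ->
     forall f, Ideal la nu f -> Ideal la (add_alpha nu i) (Phi f)) /\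
  ((0 < nth 0%N nu i)%N -> extends_F (c i nu) nu i j Phi ->
     forall f, Ideal la nu f -> Ideal la (sub_alpha nu i) (Phi f)).
Proof.
have lt_i : (i.+1 < size nu)%N by rewrite size_tuple.
split=> gt0; first exact: Ideal_E (eqP hnu) lt_i gt0.
exact: Ideal_F (eqP hnu) lt_i gt0.
Qed.
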